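(* Let $k,\beta,\rho,\delta$ be real numbers with $k>0$, $0<\beta<1$, $0<\beta\rho<1$ and $\delta>0$. Let $U=\{(u,v)\in\mathbb{R}^2 : u>0,\ v>0,\ (\rho-1)u+v>0\}$ and let $Q:U\to\mathbb{R}$ be the VES production function $$Q(u,v)=k\,u^{\delta(1-\beta\rho)}\big((\rho-1)u+v\big)^{\beta\delta\rho}.$$ Let the VES surface be the graph of $Q$, i.e. the surface in $\mathbb{R}^3$ parametrized by $G(u,v)=(u,v,Q(u,v))$, $(u,v)\in U$. Then: \begin{itemize} \item $Q$ has constant returns to scale (i.e. $\delta=1$) if and only if the VES surface is developable. \item $Q$ has decreasing returns to scale (i.e. $\delta<1$) if and only if the VES surface has positive Gaussian curvature (at all its points). \item $Q$ has increasing returns to scale (i.e. $\delta>1$) if and only if the VES surface has negative Gaussian curvature (at all its points). \end{itemize}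
   Context: The VES (Variable Elasticity of Substitution) production function is said to have constant, increasing or decreasing returns to scale if $\delta=1$, $\delta>1$ or $\delta<1$, respectively. For a smooth function $f$ on an open set $U\subset\mathbb{R}^2$, its graph is the surface in $\mathbb{R}^3$ parametrized by $F(x_1,x_2)=(x_1,x_2,f(x_1,x_2))$. The first fundamental form has matrix $I=(g_{ij})$ with $g_{ij}=\langle \partial F/\partial x_i,\partial F/\partial x_j\rangle$; the second fundamental form has matrix $II=(h_{ij})$ with $h_{ij}=\langle N,\partial^2F/\partial x_i\partial x_j\rangle$, where $N$ is the unit normal $N=\frac{\partial_{x_1}F\times\partial_{x_2}F}{\|\partial_{x_1}F\times\partial_{x_2}F\|}$. The Gaussian curvature at a point is $K=\det II/\det I$. A surface is called developable if its Gaussian curvature is zero at all its points. *)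

(* Defs.v *)
From Stdlib Require Import Reals.
From Coquelicot Require Import Coquelicot.

Open Scope R_scope.

Definition vec3 : Type := (R * R * R)%type.

Definition dot3 (x y : vec3) : R :=
  let '(x1, x2, x3) := x in
  let '(y1, y2, y3) := y in
  x1 * y1 + x2 * y2 + x3 * y3.

Definition cross3 (x y : vec3) : vec3 :=
  let '(x1, x2, x3) := x in
  let '(y1, y2, y3) := y in
  (x2 * y3 - x3 * y2, x3 * y1 - x1 * y3, x1 * y2 - x2 * y1).

Definition scal3 (a : R) (x : vec3) : vec3 :=
  let '(x1, x2, x3) := x in (a * x1, a * x2, a * x3).

Definition norm3 (x : vec3) : R := sqrt (dot3 x x).

Inductive coord : Set := X1 | X2.

(* Coquelicot's [Derive] is total, with an unspecified value at points of
   non-differentiability: the notions below have their usual meaning only where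
   the map is twice differentiable.  They depend only on the germ of the map at
   the point, so the values of a map outside its open domain are irrelevant. *)
Definition partial (i : coord) (f : R -> R -> R) (x1 x2 : R) : R :=
  match i with
  | X1 => Derive (fun t => f t x2) x1
  | X2 => Derive (fun t => f x1 t) x2
  end.

Definition partial3 (i : coord) (F : R -> R -> vec3) (x1 x2 : R) : vec3 :=
  (partial i (fun s t => fst (fst (F s t))) x1 x2,
   partial i (fun s t => snd (fst (F s t))) x1 x2,
   partial i (fun s t => snd (F s t)) x1 x2).

Definition det2 (m : coord -> coord -> R) : R :=
  m X1 X1 * m X2 X2 - m X1 X2 * m X2 X1.

Definition unit_normal (F : R -> R -> vec3) (x1 x2 : R) : vec3 :=
  let n := cross3 (partial3 X1 F x1 x2) (partial3 X2 F x1 x2) in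
  scal3 (/ norm3 n) n.

Definition first_form (F : R -> R -> vec3) (x1 x2 : R) (i j : coord) : R :=
  dot3 (partial3 i F x1 x2) (partial3 j F x1 x2).

Definition second_form (F : R -> R -> vec3) (x1 x2 : R) (i j : coord) : R :=
  dot3 (unit_normal F x1 x2) (partial3 i (partial3 j F) x1 x2).

Definition gaussian_curvature (F : R -> R -> vec3) (x1 x2 : R) : R :=
  det2 (second_form F x1 x2) / det2 (first_form F x1 x2).

Definition graph (f : R -> R -> R) (x1 x2 : R) : vec3 := (x1, x2, f x1 x2).

Definition developable (U : R -> R -> Prop) (F : R -> R -> vec3) : Prop :=
  forall x1 x2 : R, U x1 x2 -> gaussian_curvature F x1 x2 = 0.

Definition positively_curved (U : R -> R -> Prop) (F : R -> R -> vec3) : Prop :=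
  forall x1 x2 : R, U x1 x2 -> 0 < gaussian_curvature F x1 x2.

Definition negatively_curved (U : R -> R -> Prop) (F : R -> R -> vec3) : Prop :=
  forall x1 x2 : R, U x1 x2 -> gaussian_curvature F x1 x2 < 0.

Definition ves_domain (rho u v : R) : Prop :=
  0 < u /\ 0 < v /\ 0 < (rho - 1) * u + v.

(* [Rpower x y] is the real power x^y for x > 0; both bases are positive on
   [ves_domain rho]. *)
Definition ves (k beta rho delta u v : R) : R :=
  k * Rpower u (delta * (1 - beta * rho))
    * Rpower ((rho - 1) * u + v) (beta * delta * rho).

Definition ves_surface (k beta rho delta : R) : R -> R -> vec3 :=
  graph (ves k beta rho delta).

Definition constant_returns (delta : R) : Prop := delta = 1.
Definition decreasing_returns (delta : R) : Prop := delta < 1.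
Definition increasing_returns (delta : R) : Prop := 1 < delta.

(* Main.v *)
(** The Hessian determinant of a graph controls the sign of its curvature.  With
    [w = (rho - 1) u + v], [a = delta (1 - beta rho)] and [b = beta delta rho], the
    logarithmic derivatives of [Q] are [a / u + (rho - 1) b / w] and [b / w], and
    the Hessian determinant of [Q] collapses to [a b (1 - a - b) Q^2 / (u w)^2],
    where [a + b = delta]. *)

Require Import Defs.
From Stdlib Require Import Reals Lra.
From Coquelicot Require Import Coquelicot.

Open Scope R_scope.

Definition hessian (f : R -> R -> R) (x1 x2 : R) (i j : coord) : R :=
  partial i (partial j f) x1 x2.

Lemma partial3_graph (f : R -> R -> R) (i : coord) (x1 x2 : R) :
  partial3 i (graph f) x1 x2 =
  (match i with X1 => 1 | X2 => 0 end,
   match i with X1 => 0 | X2 => 1 end,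
   partial i f x1 x2).
Proof.
unfold partial3; repeat f_equal; destruct i; simpl;
  first [apply Derive_id | apply Derive_const].
Qed.

(** The first-order formula is an identity of functions, so it can be substituted under the outer
    derivative, where the constant components vanish. *)
Lemma partial3_partial3_graph (f : R -> R -> R) (i j : coord) (x1 x2 : R) :
  partial3 i (partial3 j (graph f)) x1 x2 = (0, 0, hessian f x1 x2 i j).
Proof.
assert (H := partial3_graph f j).
assert (Hp : forall g h, (forall s t, g s t = h s t) ->
  partial i g x1 x2 = partial i h x1 x2)
  by (intros g h E; destruct i; apply Derive_ext; intros t; apply E).
assert (Hc : forall r, partial i (fun _ _ => r) x1 x2 = 0)
  by (intros r; destruct i; exact (Derive_const r _)).
unfold hessian; generalize dependent (partial3 j (graph f)); intros F H.
unfold partial3; repeat apply f_equal2.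
- erewrite Hp; [apply Hc | intros s t; rewrite H; cbn [fst snd]; reflexivity].
- erewrite Hp; [apply Hc | intros s t; rewrite H; cbn [fst snd]; reflexivity].
- apply Hp; intros s t; now rewrite H.
Qed.

(** With gradient (p, q) and n = 1 + p^2 + q^2, the unit normal is (-p, -q, 1) / sqrt n, so the
    second form is the Hessian over sqrt n. Hence det II is the Hessian determinant over n, while
    det I = n. *)
Lemma gaussian_curvature_graph (f : R -> R -> R) (x1 x2 : R) :
  gaussian_curvature (graph f) x1 x2 =
  det2 (hessian f x1 x2) /
  (1 + partial X1 f x1 x2 ^ 2 + partial X2 f x1 x2 ^ 2) ^ 2.
Proof.
unfold gaussian_curvature, det2, second_form, first_form, unit_normal, norm3.
rewrite !partial3_partial3_graph, !partial3_graph.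
generalize (partial X1 f x1 x2) (partial X2 f x1 x2); intros p q.
cbn [cross3 dot3 scal3].
match goal with |- context [sqrt ?x] => set (n := x) end.
assert (Hn : n = 1 + p ^ 2 + q ^ 2) by (unfold n; ring).
assert (Hpos : 0 < n)
  by (rewrite Hn; generalize (pow2_ge_0 p) (pow2_ge_0 q); lra).
assert (Hss : sqrt n * sqrt n = n) by (apply sqrt_sqrt; lra).
clearbody n.
assert (Hs := sqrt_lt_R0 n Hpos).
set (H := hessian f x1 x2).
transitivity ((H X1 X1 * H X2 X2 - H X1 X2 * H X2 X1) / (sqrt n * sqrt n)
              / (1 + p ^ 2 + q ^ 2)).
- f_equal; [field; lra | ring].
- rewrite Hss, <- Hn; field; lra.
Qed.

Section ShearedCobbDouglas.

Variables k a b c : R.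

(** A Cobb-Douglas function k x^a y^b composed with the shear x = u, y = c u + v; [ves] is the case
    c = rho - 1. *)
Let f (u v : R) : R := k * Rpower u a * Rpower (c * u + v) b.

(** Keeping [f u v] as a factor leaves a rational cofactor, so second derivatives need no further
    work with powers. *)
Lemma is_derive_sheared_X1 (u v : R) :
  0 < u -> 0 < c * u + v ->
  is_derive (fun t => f t v) u (f u v * (a / u + c * (b / (c * u + v)))).
Proof.
intros Hu Hw; unfold f, Rpower; auto_derive; [tauto | field; lra].
Qed.

Lemma is_derive_sheared_X2 (u v : R) :
  0 < u -> 0 < c * u + v ->
  is_derive (fun t => f u t) v (f u v * (b / (c * u + v))).
Proof.
intros Hu Hw; unfold f, Rpower; auto_derive; [tauto | field; lra].
Qed.

Lemma locally_affine_pos (p q x : R) :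
  0 < p * x + q -> locally x (fun t => 0 < p * t + q).
Proof.
apply (open_comp (fun t => p * t + q) (fun y => 0 < y)).
- intros t _; apply (ex_derive_continuous (fun t => p * t + q)); auto_derive.
  exact I.
- apply open_gt.
Qed.

(** The first-order formulas are available where both bases are positive; differentiating them again
    requires them on a neighbourhood. *)
Lemma locally_sheared_X1 (u v : R) :
  0 < u -> 0 < c * u + v -> locally u (fun t => 0 < t /\ 0 < c * t + v).
Proof.
intros Hu Hw; apply filter_and; [now apply open_gt |].
now apply locally_affine_pos.
Qed.

Lemma locally_sheared_X2 (u v : R) :
  0 < c * u + v -> locally v (fun t => 0 < c * u + t).
Proof.
intros Hw; apply filter_imp with (fun t => 0 < 1 * t + c * u).
- intros t; lra.
- apply locally_affine_pos; lra.
Qed.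

(** A shear has determinant one and so preserves Hessian determinants: the value is that of k x^a
    y^b at x = u, y = c u + v. The proof confirms this entry by entry. *)
Lemma hessian_sheared (u v : R) :
  0 < u -> 0 < c * u + v ->
  det2 (hessian f u v) =
  a * b * (1 - a - b) * (f u v / (u * (c * u + v))) ^ 2.
Proof.
intros Hu Hw.
assert (P1 : forall s t, 0 < s -> 0 < c * s + t ->
  partial X1 f s t = f s t * (a / s + c * (b / (c * s + t))))
  by (intros s t Hs Ht; apply is_derive_unique, is_derive_sheared_X1; auto).
assert (P2 : forall s t, 0 < s -> 0 < c * s + t ->
  partial X2 f s t = f s t * (b / (c * s + t)))
  by (intros s t Hs Ht; apply is_derive_unique, is_derive_sheared_X2; auto).
assert (D1 := is_derive_sheared_X1 u v Hu Hw).
assert (D2 := is_derive_sheared_X2 u v Hu Hw).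
assert (L1 := locally_sheared_X1 u v Hu Hw).
assert (L2 := locally_sheared_X2 u v Hw).
(* Product rule with the derivative of [f] already inserted: only the rational cofactor [g] remains
   to be differentiated. *)
assert (S1 : forall g l, is_derive g u l ->
  is_derive (fun s => f s v * g s) u
    (f u v * (a / u + c * (b / (c * u + v))) * g u + f u v * l))
  by (intros g l Hg; apply (is_derive_mult (fun s => f s v)); trivial;
      intros; apply Rmult_comm).
assert (S2 : forall g l, is_derive g v l ->
  is_derive (fun t => f u t * g t) v
    (f u v * (b / (c * u + v)) * g v + f u v * l))
  by (intros g l Hg; apply (is_derive_mult (fun t => f u t)); trivial;
      intros; apply Rmult_comm).
assert (H11 : hessian f u v X1 X1 =
  f u v * ((a / u + c * (b / (c * u + v))) ^ 2
           - a / u ^ 2 - c ^ 2 * b / (c * u + v) ^ 2)).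
{ unfold hessian; apply is_derive_unique.
  apply is_derive_ext_loc with
    (fun s => f s v * (a / s + c * (b / (c * s + v)))).
  - apply filter_imp with (2 := L1); intros s [Hs Ht]; now rewrite P1.
  - evar_last.
    + apply (S1 (fun s => a / s + c * (b / (c * s + v)))); auto_derive;
        [repeat split; lra | reflexivity].
    + field; lra. }
assert (H12 : hessian f u v X1 X2 =
  f u v * ((a / u + c * (b / (c * u + v))) * (b / (c * u + v))
           - c * b / (c * u + v) ^ 2)).
{ unfold hessian; apply is_derive_unique.
  apply is_derive_ext_loc with (fun s => f s v * (b / (c * s + v))).
  - apply filter_imp with (2 := L1); intros s [Hs Ht]; now rewrite P2.
  - evar_last.
    + apply (S1 (fun s => b / (c * s + v))); auto_derive;
        [repeat split; lra | reflexivity].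
    + field; lra. }
(* The mixed partials are shown equal by computing the other order directly, not by Schwarz's
   theorem. *)
assert (H21 : hessian f u v X2 X1 = hessian f u v X1 X2).
{ rewrite H12; unfold hessian; apply is_derive_unique.
  apply is_derive_ext_loc with
    (fun t => f u t * (a / u + c * (b / (c * u + t)))).
  - apply filter_imp with (2 := L2); intros t Ht; now rewrite P1.
  - evar_last.
    + apply (S2 (fun t => a / u + c * (b / (c * u + t)))); auto_derive;
        [repeat split; lra | reflexivity].
    + field; lra. }
assert (H22 : hessian f u v X2 X2 =
  f u v * ((b / (c * u + v)) ^ 2 - b / (c * u + v) ^ 2)).
{ unfold hessian; apply is_derive_unique.
  apply is_derive_ext_loc with (fun t => f u t * (b / (c * u + t))).
  - apply filter_imp with (2 := L2); intros t Ht; now rewrite P2.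
  - evar_last.
    + apply (S2 (fun t => b / (c * u + t))); auto_derive;
        [repeat split; lra | reflexivity].
    + field; lra. }
unfold det2; rewrite H21, H11, H12, H22.
(* What remains is a rational identity in which the value of [f] is a mere variable. *)
generalize (f u v); intros y.
field; lra.
Qed.

End ShearedCobbDouglas.

(** Only the sign of the curvature matters, so all positive factors are gathered in C. *)
Lemma ves_curvature (k beta rho delta u v : R) :
  0 < k -> 0 < beta * rho < 1 -> 0 < delta -> ves_domain rho u v ->
  exists C, 0 < C /\
    gaussian_curvature (ves_surface k beta rho delta) u v = C * (1 - delta).
Proof.
intros Hk Hbr Hd [Hu [_ Hw]].
set (f := ves k beta rho delta).
assert (Hf : 0 < f u v)
  by (unfold f, ves, Rpower; repeat apply Rmult_lt_0_compat;
      trivial; apply exp_pos).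
(* This is a b (Q / (u w))^2 over (1 + |grad Q|^2)^2; both a and b are positive because 0 < beta rho
   < 1. *)
exists (delta * (1 - beta * rho) * (delta * (beta * rho))
        * (f u v / (u * ((rho - 1) * u + v))) ^ 2
        / (1 + partial X1 f u v ^ 2 + partial X2 f u v ^ 2) ^ 2).
split.
- apply Rdiv_lt_0_compat.
  + apply Rmult_lt_0_compat.
    * apply Rmult_lt_0_compat; apply Rmult_lt_0_compat; lra.
    * now apply pow_lt, Rdiv_lt_0_compat, Rmult_lt_0_compat.
  + apply pow_lt; generalize (pow2_ge_0 (partial X1 f u v))
      (pow2_ge_0 (partial X2 f u v)); lra.
- unfold ves_surface; rewrite gaussian_curvature_graph; fold f.
  (* The exponents are written as in [ves] so that [hessian_sheared] applies; [ring] then turns 1 -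
     a - b into 1 - delta. *)
  replace (det2 (hessian f u v)) with
    (delta * (1 - beta * rho) * (beta * delta * rho)
     * (1 - delta * (1 - beta * rho) - beta * delta * rho)
     * (f u v / (u * ((rho - 1) * u + v))) ^ 2)
    by (symmetry; apply hessian_sheared; trivial).
  unfold Rdiv; ring.
Qed.

Theorem theorem3p4 :
  forall k beta rho delta : R,
    0 < k -> 0 < beta < 1 -> 0 < beta * rho < 1 -> 0 < delta ->
    (constant_returns delta <->
       developable (ves_domain rho) (ves_surface k beta rho delta)) /\
    (decreasing_returns delta <->
       positively_curved (ves_domain rho) (ves_surface k beta rho delta)) /\
    (increasing_returns delta <->
       negatively_curved (ves_domain rho) (ves_surface k beta rho delta)).
Proof.
intros k beta rho delta Hk Hb Hbr Hd.
(* Positivity of rho puts (1, 1) in the domain, where w = rho; each converse reads off the sign of 1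
   - delta at this single point. *)
assert (Hrho : 0 < rho)
  by (apply Rmult_lt_reg_l with beta; lra).
assert (H11 : ves_domain rho 1 1) by (unfold ves_domain; lra).
assert (HK := fun u v => ves_curvature k beta rho delta u v Hk Hbr Hd).
unfold constant_returns, decreasing_returns, increasing_returns,
  developable, positively_curved, negatively_curved.
repeat split;
  [ intros H u v Huv; destruct (HK u v Huv) as [C [HC ->]]; rewrite H; ring
  | intros H; specialize (H 1 1 H11); destruct (HK 1 1 H11) as [C [HC E]]
  | intros H u v Huv; destruct (HK u v Huv) as [C [HC ->]]
  | intros H; specialize (H 1 1 H11); destruct (HK 1 1 H11) as [C [HC E]]
  | intros H u v Huv; destruct (HK u v Huv) as [C [HC ->]]
  | intros H; specialize (H 1 1 H11); destruct (HK 1 1 H11) as [C [HC E]] ];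
  try rewrite E in H.
- destruct (Rmult_integral _ _ H); lra.
- apply Rmult_lt_0_compat; lra.
- apply Rmult_lt_reg_l with C; lra.
- replace 0 with (C * 0) by ring; apply Rmult_lt_compat_l; lra.
- apply Rmult_lt_reg_l with C; lra.
Qed.
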